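(* Let $d$ be a prime, and let $c_0\in\mathbb{C}$ be a root of $G_{d,n}$ for some $n \geq 2$. Set $K = \mathbb{Q}(c_0)$. Then, for any $k \geq 1$, the polynomial $f_{d,c_0}^k$ has $k - \lfloor k/n \rfloor + 1$ distinct irreducible factors over $K$.
   Context: For a prime $d$ and $c_0\in\mathbb{C}$, $f_{d,c_0}=x^d+c_0$. For a polynomial $f$, $f^n$ denotes the $n$-th iterate: $f^0=x$, $f^n=f\circ f^{n-1}$ for $n\ge 1$. Define polynomials $a_i=a_i(c)\in\mathbb{Z}[c]$ (depending on $d$) by $a_1=c$ and $a_{i+1}=a_i^d+c$ for $i\ge 1$. For $n\ge 1$, $G_{d,n}=G_{d,0,n}\in\mathbb{Z}[c]$ is the monic polynomial $$G_{d,n}(c):=\prod_{k\mid n}(a_k)^{\mu(n/k)},$$ where $\mu$ is the Möbius function. (Its roots are the Gleason parameters of period $n$, i.e. those $c_0$ with $f_{d,c_0}^n(0)=0$ and $f_{d,c_0}^i(0)\ne 0$ for $0<i<n$.) Irreducible factors are counted without multiplicity, as monic polynomials in $K[x]$. *)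

(* Defs.v *)
From HB Require Import structures.
From mathcomp Require Import all_boot all_order all_algebra.
From mathcomp Require Import complex.
From mathcomp Require Import boolp classical_sets functions cardinality reals.

Set Implicit Arguments.
Unset Strict Implicit.
Unset Printing Implicit Defensive.

Import GRing.Theory.
Local Open Scope ring_scope.

Section SimpleExtension.
Variables (F : fieldType) (z : F).

(* The smallest subfield of F containing z; over a field of characteristic 0
   such as R[i], this is Q(z). *)
Definition in_adjoin : {pred F} :=
  fun x => `[< forall S : {pred F}, divring_closed S -> z \in S -> x \in S >].

Lemma in_adjoinP x :
  reflect (forall S : {pred F}, divring_closed S -> z \in S -> x \in S)
          (x \in in_adjoin).
Proof. exact: asboolP. Qed.

Fact in_adjoin_divring_closed : divring_closed in_adjoin.
Proof.
split=> [|x y /in_adjoinP xS /in_adjoinP yS|x y /in_adjoinP xS /in_adjoinP yS];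
  apply/in_adjoinP => S SP zS; case: (SP) => [S1 SB SD].
- exact: S1.
- by apply: SB; [apply: xS | apply: yS].
- by apply: SD; [apply: xS | apply: yS].
Qed.

HB.instance Definition _ :=
  GRing.isDivringClosed.Build F in_adjoin in_adjoin_divring_closed.

Record adjoin : Type :=
  Adjoin { adjoin_val :> F; adjoin_valP : adjoin_val \in in_adjoin }.

HB.instance Definition _ := [isSub for adjoin_val].
HB.instance Definition _ := [Choice of adjoin by <:].
HB.instance Definition _ :=
  [SubChoice_isSubIntegralDomain of adjoin by <:].
HB.instance Definition _ := [SubIntegralDomain_isSubField of adjoin by <:].

Fact adjoin_gen_subproof : z \in in_adjoin.
Proof. by apply/in_adjoinP. Qed.

Definition adjoin_gen : adjoin := Adjoin adjoin_gen_subproof.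

End SimpleExtension.

Definition poly_iter (A : comNzRingType) (f : {poly A}) (k : nat) : {poly A} :=
  iter k (fun g => f \Po g) 'X.

Definition unicritical (A : comNzRingType) (d : nat) (c : A) : {poly A} :=
  'X^d + c%:P.

Definition irreducible_factors (K : fieldType) (p : {poly K}) :
    set {poly K} :=
  [set g | [/\ g \is monic, irreducible_poly g & g %| p]]%classic.

Definition mobius (n : nat) : int :=
  if all (fun p => logn p n == 1%N) (primes n) then (-1) ^+ size (primes n)
  else 0.

(* Meaningful for i >= 1 only; the variable 'X stands for the parameter c. *)
Definition crit_orbit (d i : nat) : {poly int} :=
  iter i.-1 (fun a => a ^+ d + 'X) 'X.

(* The exponents can be -1, so the product is formed in the field of fractions
   of Z[c]; for d prime and n >= 1 it lies in Z[c] (the default value 0 is not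
   used), and it determines the polynomial since tofrac is injective. *)
Definition gleason (d n : nat) : {poly int} :=
  xget 0 [set G : {poly int} | tofrac G =
    \prod_(k <- divisors n) tofrac (crit_orbit d k) ^ mobius (n %/ k)]%classic.

(* Main.v *)
From HB Require Import structures.
Require Import Defs.
From mathcomp Require Import all_boot all_order all_algebra all_field.
From mathcomp Require Import finmap complex ring.
From mathcomp Require Import boolp classical_sets functions cardinality reals.

Import Order.TTheory GRing.Theory Num.Theory.
Local Open Scope ring_scope.

(** Let f = x^d + z with z = c0, and a_j = f^j(0), a polynomial in z.

    Being a root of the Gleason polynomial means that 0 has exact period n
    under f, that is, a_j = 0 if and only if n divides j ([gleason_root]).
    Fix k and put e = k(n-1), so that f^k(a_e) = a_(k+e) = 0.  With
    chord(x, y) = (x^d - y^d)/(x - y), the differences f^m(x) - f^m(a_e)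
    telescope into

      f^k(x) = (x - a_e) P_0(x) ... P_(k-1)(x),
      P_m(x) = chord(f^m(x), a_(m+e)).

    If n divides m+e, then P_m is a power of f^m, which is the product of
    x - a_e and the earlier P_j: such an m contributes no new factor, and
    there are floor(k/n) of them.  All the other P_m are irreducible over
    Q(c0); they differ from each other by their degrees, and from x - a_e
    because P_m(a_e) = d a_(m+e)^(d-1) is nonzero.  This gives
    1 + k - floor(k/n) factors.

    Irreducibility is Eisenstein's criterion at d ([chord_irreducible]).
    Modulo d the d-th power map is additive, so P_m(x + a_e) is congruent to
    x^N, where N is its degree, and its constant term is d a_(m+e)^(d-1).
    Here a_(m+e) is a unit of Z[c0]: a_(jn) = a_j (1 + a_j r) identically,
    and the left side vanishes.  Finally d is unramified in Q(c0), since c0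
    is a root of the monic polynomial a_n, whose derivative in c is 1 modulo
    d, so that the minimal polynomial of c0 is separable modulo d.

    As Z[c0] need not be integrally closed and d need not be prime in it, the
    criterion is proved by integrality instead of a valuation
    ([eisenstein_independence]): if b is a root of an Eisenstein polynomial,
    every coefficient of a linear relation over Z[c0] between 1, b, ...,
    b^(N-1) has the form b times an algebraic integer, hence a power of it is
    d times an algebraic integer, hence (Z[c0]/d being reduced) it is
    divisible by d; infinite descent then kills the relation. *)

(** * Iteration of x^d + c in a commutative ring *)

(** Iterates at an element rather than as polynomials: taking for the ring Z[c],
    K[x] or Z[c][x] covers critical orbits, iterated polynomials and their
    specializations, and [rmorph_uiter] moves between them. *)
Definition uiter (A : comNzRingType) (d : nat) (c : A) (m : nat) (y : A) : A :=
  iter m (fun t => t ^+ d + c) y.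

(** The slope (x^d - y^d)/(x - y), see [chordE]; unlike the quotient it makes
    sense on the diagonal. *)
Definition chord (A : comNzRingType) (d : nat) (x y : A) : A :=
  \sum_(i < d) x ^+ (d.-1 - i) * y ^+ i.

Lemma uiterS (A : comNzRingType) d (c : A) m y :
  uiter A d c m.+1 y = uiter A d c m y ^+ d + c.
Proof. by []. Qed.

Lemma uiterD (A : comNzRingType) d (c : A) m k y :
  uiter A d c (m + k) y = uiter A d c m (uiter A d c k y).
Proof. exact: iterD. Qed.

Lemma rmorph_uiter (A B : comNzRingType) (f : {rmorphism A -> B}) d c m y :
  f (uiter A d c m y) = uiter B d (f c) m (f y).
Proof. by elim: m => //= m IH; rewrite rmorphD rmorphXn IH. Qed.

Lemma rmorph_chord (A B : comNzRingType) (f : {rmorphism A -> B}) d x y :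
  f (chord A d x y) = chord B d (f x) (f y).
Proof.
by rewrite rmorph_sum; apply: eq_bigr => i _; rewrite rmorphM !rmorphXn.
Qed.

Lemma chordE (A : comNzRingType) d (x y : A) :
  x ^+ d - y ^+ d = (x - y) * chord A d x y.
Proof. exact: subrXX. Qed.

Lemma chord_diag (A : comNzRingType) d (x : A) :
  chord A d x x = x ^+ d.-1 *+ d.
Proof.
rewrite /chord (eq_bigr (fun=> x ^+ d.-1)) ?sumr_const ?card_ord // => i _.
by rewrite -exprD subnK // -ltnS (leq_trans (ltn_ord i)) // leqSpred.
Qed.

Lemma chord0 (A : comNzRingType) d (x : A) : (0 < d)%N ->
  chord A d x 0 = x ^+ d.-1.
Proof.
case: d => // d _; rewrite /chord big_ord_recl /= subn0 expr0 mulr1.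
by rewrite big1 ?addr0 // => i _; rewrite expr0n mulr0.
Qed.

Lemma uiter_chord (A : comNzRingType) d (c : A) m x y :
  uiter A d c m.+1 x - uiter A d c m.+1 y =
  (uiter A d c m x - uiter A d c m y)
    * chord A d (uiter A d c m x) (uiter A d c m y).
Proof. by rewrite !uiterS -chordE opprD addrACA subrr addr0. Qed.

(** The map x^d + c has 0 as a critical point, so each iterate is constant to
    first order there. *)
Lemma uiter_dvd (A : comNzRingType) d (c : A) m y : (1 < d)%N ->
  exists r, uiter A d c m.+1 y = uiter A d c m.+1 0 + y ^+ 2 * r.
Proof.
move=> d1; elim: m => [|m [r IH]].
  exists (y ^+ (d - 2)).
  by rewrite !uiterS /= expr0n -exprD subnKC // gtn_eqF ?add0r 1?addrC // ltnW.
exists (r * chord A d (uiter A d c m.+1 y) (uiter A d c m.+1 0)).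
apply/eqP; rewrite addrC -subr_eq uiter_chord IH.
by rewrite [X in X - _]addrC addrK mulrA.
Qed.

(** Applying [uiter_dvd] to f^j at y = f^(j(n-1))(0), a multiple of f^j(0),
    changes f^j(0) by a multiple of f^j(0)^2 only.  If f^(jn)(0) = 0, this makes
    f^j(0) zero or a unit. *)
Lemma uiter_mul (A : comNzRingType) d (c : A) j n : (1 < d)%N ->
  (0 < j)%N -> (0 < n)%N ->
  exists r, uiter A d c (j * n) 0
            = uiter A d c j 0 * (1 + uiter A d c j 0 * r).
Proof.
case: j => // j; set a := uiter A d c j.+1 0.
move=> d1 _; case: n => // n _; elim: n => [|n [r IH]].
  by exists 0; rewrite muln1 mulr0 addr0 mulr1.
rewrite mulnS uiterD IH; have [s ->] := uiter_dvd A d c j (a * (1 + a * r)) d1.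
exists ((1 + a * r) ^+ 2 * s); rewrite -/a.
ring.
Qed.

(** In characteristic d the map x^d + c is additive up to a constant. *)
Lemma uiter_pchar (A : comNzRingType) d (c x y : A) m :
  d \in [pchar A] -> uiter A d c m (x + y) = x ^+ (d ^ m) + uiter A d c m y.
Proof.
move=> dA; have dn : [pchar A].-nat d.
  by rewrite (eq_pnat _ (pcharf_eq dA)) pnat_id // (pcharf_prime dA).
elim: m => [|m IH]; first by rewrite expn0 expr1.
by rewrite !uiterS IH exprDn_pchar // -exprM -expnSr addrA.
Qed.

(** In characteristic d one has (x + y)^d - y^d = x^d. *)
Lemma chord_pchar (A : idomainType) d (x y : A) : d \in [pchar A] -> x != 0 ->
  chord A d (x + y) y = x ^+ d.-1.
Proof.
move=> dA x0; have dn : [pchar A].-nat d.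
  by rewrite (eq_pnat _ (pcharf_eq dA)) pnat_id // (pcharf_prime dA).
apply: (mulfI x0); rewrite -{1}(addrK y x) -chordE exprDn_pchar // addrK.
by rewrite -exprS prednK // prime_gt0 // (pcharf_prime dA).
Qed.

Lemma crit_orbitE d i : (0 < d)%N ->
  crit_orbit d i.+1 = uiter {poly int} d 'X i.+1 0.
Proof.
by move=> d0; rewrite /crit_orbit /uiter iterSr expr0n gtn_eqF // add0r.
Qed.

Lemma poly_iterE (A : comNzRingType) d (c : A) k :
  poly_iter (unicritical d c) k = uiter {poly A} d c%:P k 'X.
Proof.
elim: k => //= k IH; rewrite -/(poly_iter _ k) IH /unicritical.
by rewrite comp_polyD comp_polyC comp_Xn_poly.
Qed.

Lemma size_monicX (A : idomainType) (p : {poly A}) n : p \is monic ->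
  size (p ^+ n) = ((size p).-1 * n).+1.
Proof.
by move=> mon; rewrite -size_exp prednK // size_poly_gt0 monic_neq0 ?monic_exp.
Qed.

Lemma size_uiter (A : idomainType) d (c e : A) m : (1 < d)%N ->
  let p := uiter {poly A} d c%:P m ('X + e%:P) in
  p \is monic /\ size p = (d ^ m).+1.
Proof.
move=> d1 /=; elim: m => [|m [mon sz]].
  by rewrite expn0 /= size_XaddC monicE lead_coefDl ?lead_coefX ?size_polyX //
     size_polyC ltnS; case: eqP.
have szX : size (uiter {poly A} d c%:P m ('X + e%:P) ^+ d) = (d ^ m.+1).+1.
  by rewrite size_monicX // sz /= expnSr.
have small : (size c%:P < (d ^ m.+1).+1)%N.
  by rewrite (leq_ltn_trans (size_polyC_leq1 _)) // ltnS expn_gt0 ltnW.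
rewrite uiterS; split; last by rewrite size_polyDl szX.
by rewrite monicE lead_coefDl ?szX // -monicE monic_exp.
Qed.

Lemma size_chord (A : idomainType) d (p : {poly A}) (b : A) : (1 < d)%N ->
  p \is monic -> (1 < size p)%N ->
  chord {poly A} d p b%:P \is monic /\
  size (chord {poly A} d p b%:P) = (d.-1 * (size p).-1).+1.
Proof.
move=> d1 mon szp.
have pb0 : (size b%:P < size p)%N by rewrite (leq_ltn_trans (size_polyC_leq1 _)).
have monB : p - b%:P \is monic.
  by rewrite monicE lead_coefDl ?size_polyN // -monicE.
have szB : size (p - b%:P) = size p by rewrite size_polyDl ?size_polyN.
have szX : size (p ^+ d) = (d * (size p).-1).+1.
  by rewrite size_monicX // mulnC.
have small : (size (b%:P ^+ d) < size (p ^+ d))%N.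
  rewrite -rmorphXn (leq_ltn_trans (size_polyC_leq1 _)) // szX ltnS muln_gt0.
  by rewrite ltnW //= -ltnS prednK // ltnW.
have E := chordE {poly A} d p b%:P.
have monL : p ^+ d - b%:P ^+ d \is monic.
  by rewrite monicE lead_coefDl ?size_polyN // -monicE monic_exp.
have monC : chord {poly A} d p b%:P \is monic.
  by rewrite -(monicMl _ monB) -E.
split=> //.
have := congr1 (fun q : {poly A} => size q) E.
rewrite size_polyDl ?size_polyN // szX size_monicM ?monic_neq0 // szB.
have s0 : (0 < size (chord {poly A} d p b%:P))%N.
  by rewrite size_poly_gt0 monic_neq0.
move: (size _) s0 (size p) szp => [//|sc] _ [//|sp] _.
case: d d1 {pb0 monB szB szX small E monL monC} => // d _ /=.
by rewrite mulSn addnS /= => -[/addnI ->].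
Qed.

(** * Integral polynomials at an algebraic integer *)

Definition int_eval (A : comNzRingType) (z : A) (p : {poly int}) : A :=
  (map_poly intr p).[z].

HB.instance Definition _ (A : comNzRingType) (z : A) :=
  GRing.RMorphism.copy (int_eval A z) (horner_eval z \o map_poly intr).

Lemma int_evalX (A : comNzRingType) (z : A) : int_eval A z 'X = z.
Proof. by rewrite /int_eval map_polyX hornerX. Qed.

Lemma int_evalZ (A : comNzRingType) (z : A) k p :
  int_eval A z (k *: p) = k%:~R * int_eval A z p.
Proof. by rewrite /int_eval map_polyZ hornerZ. Qed.

Lemma rmorph_int_eval (A B : comNzRingType) (f : {rmorphism A -> B}) z p :
  f (int_eval A z p) = int_eval B (f z) p.
Proof.
rewrite /int_eval -horner_map -map_poly_comp.
by congr (_.[_]); apply: eq_map_poly => k /=; rewrite rmorph_int.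
Qed.

(** A primitive integral polynomial of least degree vanishing at z divides, by
    pseudo-division and Gauss's lemma, all the others; dividing the monic [a]
    makes it monic up to sign. *)
Lemma int_minpoly (F : numFieldType) (z : F) (a : {poly int}) :
  a \is monic -> int_eval F z a = 0 ->
  exists g : {poly int}, [/\ g \is monic, int_eval F z g = 0 &
    forall p, int_eval F z p = 0 -> exists q, p = q * g].
Proof.
move=> mona az.
pose P n := `[< exists p : {poly int},
  [/\ p != 0, size p = n & int_eval F z p = 0] >].
have exP : exists n, P n.
  by exists (size a); apply/asboolP; exists a; rewrite monic_neq0.
have [_ /asboolP [g0 [g0N <- g0z]] mini] := ex_minnP exP.
have dvd p : int_eval F z p = 0 -> exists q, p = zprimitive g0 * q.
  move=> pz; have E := Pdiv.ComRing.rdivp_eq g0 p.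
  suff r0 : Pdiv.Ring.rmodp p g0 = 0.
    have /dvdpP_int[r ->] : g0 %| p; last by exists r.
    apply/Pdiv.Idomain.dvdpP.
    exists (lead_coef g0 ^+ Pdiv.Ring.rscalp p g0, Pdiv.Ring.rdivp p g0) => /=.
      by rewrite expf_neq0 ?lead_coef_eq0.
    by rewrite E r0 addr0.
  apply: contraTeq (Pdiv.Ring.ltn_rmodpN0 p g0N) => rN0.
  rewrite -leqNgt; apply: mini; apply/asboolP; eexists; split; eauto.
  have := congr1 (int_eval F z) E.
  by rewrite int_evalZ pz mulr0 rmorphD rmorphM /= g0z mulr0 add0r.
exists (zprimitive g0); split.
- have [r ar] := dvd a az.
  have := congr1 lead_coef ar; rewrite lead_coefM (monicP mona) => /esym lr.
  have := sgz_lead_primitive g0; rewrite g0N => /eqP.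
  rewrite sgz_cp0 => lpos; rewrite monicE.
  have := congr1 absz lr; rewrite abszM => /eqP; rewrite muln_eq1.
  by case/andP => /eqP l1 _; rewrite -[lead_coef _]gtz0_abs // l1.
- have := g0z; rewrite {1}[g0]zpolyEprim int_evalZ => /eqP.
  by rewrite mulf_eq0 intr_eq0 zcontents_eq0 (negPf g0N) /= => /eqP.
- by move=> p /dvd [q ->]; exists q; rewrite mulrC.
Qed.

(** Write g = s r with r = gcd(g, t).  As g is squarefree, s is coprime to r, hence
    to t; dividing t^M, it is constant. *)
Lemma separable_dvd_exp (F : fieldType) (g t : {poly F}) M :
  separable_poly g -> g %| t ^+ M -> g %| t.
Proof.
move=> sepg dvdM; set r := gcdp g t.
have gE : g = (g %/ r) * r by rewrite divpK ?dvdp_gcdl.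
set s := g %/ r in gE.
have : separable_poly (s * r) by rewrite -gE.
rewrite separable_mul => /and3P [_ _ csr].
have cst : coprimep s t.
  apply/coprimepP => u us ut; move/coprimepP: csr; apply=> //.
  by rewrite dvdp_gcd ut andbT gE dvdp_mulr.
have : coprimep s (t ^+ M) by rewrite coprimep_sym coprimep_expl // coprimep_sym.
have sM : s %| t ^+ M by apply: dvdp_trans dvdM; rewrite gE dvdp_mulr.
rewrite /coprimep (eqp_size (dvdp_gcd_idl sM)) size_poly_eq1 => /eqpP.
case=> -[c1 c2] /= /andP[c1N c2N] sE; rewrite gE.
rewrite -(dvdpZl _ _ c1N) scalerAl sE -scalerAl mul1r dvdpZl //.
exact: dvdp_gcdr.
Qed.

Lemma intr_Fp_eq0 p (x : int) : prime p ->
  (x%:~R == 0 :> 'F_p) = (p %| `|x|)%N.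
Proof.
move=> pp; rewrite (dvdn_pcharf (pchar_Fp pp)).
by case: x => n; rewrite ?NegzE ?mulrNz ?oppr_eq0 -pmulrn ?abszN.
Qed.

Lemma map_Fp_eq0 p (q : {poly int}) : prime p ->
  map_poly (intr : int -> 'F_p) q = 0 -> exists q', q = p%:Z *: q'.
Proof.
move=> pp q0; exists (map_poly (fun x => (x %/ p)%Z) q).
apply/polyP=> i; rewrite coefZ coef_map_id0 ?div0z // mulrC divzK // dvdzE /=.
by rewrite -intr_Fp_eq0 // -coef_map q0 coef0.
Qed.

(** If x is a root of the monic polynomial p of degree D, then k^D p(X/k) is monic,
    vanishes at k x, and its lower coefficients are divisible by k.  So the D-th
    power of t is divisible by k in Z[z], although x itself need not lie in
    Z[z]. *)
Lemma integral_multiple (F : fieldType) (z x : F) (k : int) (t : {poly int}) :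
  integralOver (intr : int -> F) x -> int_eval F z t = k%:~R * x ->
  exists D q, int_eval F z (t ^+ D + k *: q) = 0.
Proof.
case=> p monp px tx; pose D := (size p).-1.
have szp : size p = D.+1 by rewrite prednK // size_poly_gt0 monic_neq0.
exists D, (\sum_(i < D) (p`_i * k ^+ (D - i.+1)) *: t ^+ i).
have pD : p`_D = 1 by rewrite -(monicP monp) lead_coefE.
have : k%:~R ^+ D * (map_poly intr p).[x] = 0 by rewrite (eqP px) mulr0.
rewrite (@horner_coef_wide _ D.+1) -?szp ?size_poly // szp.
rewrite big_ord_recr /= coef_map pD /= mul1r mulrDr -exprMn -tx => E.
rewrite rmorphD rmorphXn /= -{}E addrC; congr (_ + _).
rewrite int_evalZ rmorph_sum !mulr_sumr /=; apply: eq_bigr => i _.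
rewrite int_evalZ rmorphXn /= tx coef_map /= rmorphM rmorphXn /=.
have -> : k%:~R ^+ D = k%:~R ^+ (D - i.+1) * (k%:~R * k%:~R ^+ i) :> F.
  by rewrite -exprS -exprD subnK.
rewrite exprMn.
ring.
Qed.

Lemma scale_polyI (A : idomainType) (k : A) :
  k != 0 -> injective (fun p : {poly A} => k *: p).
Proof.
move=> k0 p q /=; rewrite -!mul_polyC => /mulfI; apply.
by rewrite polyC_eq0.
Qed.

(** Separability modulo d means that Z[z]/d = F_d[x]/g is reduced, hence that d is
    unramified in Q(z) and that Z[z] is integrally closed locally at d. *)
Record unramified_minpoly (F : numFieldType) (d : nat) (z : F)
    (g : {poly int}) : Prop := UnramifiedMinpoly {
  um_monic : g \is monic;
  um_root : int_eval F z g = 0;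
  um_min : forall p, int_eval F z p = 0 -> exists q, p = q * g;
  um_separable : separable_poly (map_poly (intr : int -> 'F_d) g)
}.

(** * Eisenstein's criterion over Z[z] at an unramified prime *)

Section Eisenstein.

Variables (F : numFieldType) (d : nat) (z : F) (g : {poly int}).
Hypotheses (d_prime : prime d) (gP : unramified_minpoly F d z g).

Local Notation ev := (int_eval F z).
Local Notation red := (map_poly (intr : int -> 'F_d)).
Local Notation int_over x := (integralOver (intr : int -> F) x).

Lemma int_eval_integral p : int_over (ev p).
Proof.
apply: integral_horner => [|].
  by apply/integral_poly => i; rewrite coef_map; exact: integral_id.
by exists g; [exact: (um_monic _ _ _ _ gP) | apply/eqP; exact: (um_root _ _ _ _ gP)].
Qed.

(** Some power of t is divisible by d in Z[z] by [integral_multiple], and Z[z]/d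
    is reduced.  The bound on the size makes t the canonical representative of
    its class in Z[z]. *)
Lemma dvd_of_pow_integral_multiple (t : {poly int}) M x :
  (size t < size g)%N -> int_over x -> ev (t ^+ M) = d%:R * x ->
  exists t', t = d%:Z *: t'.
Proof.
move=> szt xint tx; have [D [q]] := integral_multiple _ _ _ d%:Z _ xint tx.
move=> /(um_min _ _ _ _ gP) [h hE].
apply: map_Fp_eq0 => //; 
have : red g %| red t.
  apply: (separable_dvd_exp _ _ _ (M * D)); first exact: (um_separable _ _ _ _ gP).
  have := congr1 red hE; rewrite rmorphD rmorphM !rmorphXn /= map_polyZ /=.
  rewrite -pmulrn pchar_Fp_0 // scale0r addr0 -exprM => ->.
  exact: dvdp_mull.
apply: contraTeq => t0; apply/negP => /dvdp_leq - /(_ t0).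
rewrite leqNgt => /negP; apply.
have -> : size (red g) = size g.
  rewrite size_map_poly_id0 // (monicP (um_monic _ _ _ _ gP)) oner_eq0.
  by [].
exact: leq_ltn_trans (size_poly _ _) szt.
Qed.


Let int_over_sum (I : Type) (r : seq I) (f : I -> F) :
  (forall i, int_over (f i)) -> int_over (\sum_(i <- r) f i).
Proof.
move=> fint; apply: big_ind => //; first exact: integral0.
by move=> x y; exact: integral_add.
Qed.

Let int_overX x n : int_over x -> int_over (x ^+ n).
Proof.
move=> xint; elim: n => [|n IH]; first exact: integral1.
by rewrite exprS; exact: integral_mul.
Qed.

Variables (S : {poly {poly int}}) (N : nat) (u v : {poly int}) (b : F).
Hypotheses (S_monic : S \is monic) (S_size : size S = N.+1).
Hypotheses (S_red : map_poly red S = 'X^N) (S0 : S`_0 = u *+ d).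
Hypotheses (uv1 : ev u * ev v = 1) (Sb : (map_poly ev S).[b] = 0).

Let b_int : int_over b.
Proof.
apply: (@integral_root_monic _ _ _ _ (map_poly ev S)).
- exact: monic_map.
- exact/eqP.
- by apply/integral_poly => i; rewrite coef_map; exact: int_eval_integral.
Qed.

(* The N-th power of b is d times an element that is a unit modulo b. *)
Let b_pow : (0 < N)%N ->
  exists2 w, b ^+ N = - (d%:R * (ev u + b * w)) & int_over w.
Proof.
move=> N0.
have /choice [t tE] : forall i, exists t : {poly int}, (i < N)%N ->
    S`_i = d%:Z *: t.
  move=> i; case: (ltnP i N) => [iN|_]; last by exists 0.
  have [|t ->] := map_Fp_eq0 d S`_i d_prime; last by exists t.
  have := congr1 (fun p : {poly {poly 'F_d}} => p`_i) S_red.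
  by rewrite coef_map coefXn ltn_eqF.
have t0 : t 0%N = u.
  have d0 : d%:Z != 0 by rewrite eqz_nat -lt0n prime_gt0.
  apply: (scale_polyI _ _ d0); rewrite -tE // S0 -scaler_nat.
  by congr (_ *: _); rewrite natz.
exists (\sum_(i < N.-1) ev (t i.+1) * b ^+ i); last first.
  by apply: int_over_sum => i; apply: integral_mul;
    [exact: int_eval_integral | exact: int_overX].
apply/eqP; rewrite -addr_eq0 addrC; apply/eqP.
rewrite -[RHS]Sb (@horner_coef_wide _ N.+1) ?(leq_trans (size_poly _ _)) ?S_size //.
rewrite big_ord_recr /= coef_map /=.
have -> : S`_N = 1 by rewrite -(monicP S_monic) lead_coefE S_size.
rewrite rmorph1 mul1r; congr (_ + _).
rewrite -[in RHS](prednK N0) big_ord_recl /= expr0 mulr1 coef_map /= tE // t0.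
rewrite int_evalZ mulrDr; congr (_ + _); rewrite !mulr_sumr; apply: eq_bigr => i _.
rewrite coef_map /= tE; last by rewrite /bump /= add1n -ltn_predRL.
by rewrite int_evalZ /bump /= add1n exprS -pmulrn; ring.
Qed.

Let b_neq0 : (0 < N)%N -> b != 0.
Proof.
move=> N0; have [w bN _] := b_pow N0; apply/eqP => b0.
move: bN; rewrite b0 expr0n gtn_eqF // mul0r addr0 => /esym/eqP.
rewrite oppr_eq0 mulf_eq0 pnatr_eq0 -leqn0 leqNgt prime_gt0 //= => /eqP u0.
by have := uv1; rewrite u0 mul0r => /esym/eqP; rewrite oner_eq0.
Qed.

(* The coefficients are treated from the lowest one up.  When those below j
   are divisible by d, multiplying the relation by the cofactor of d in b^N turns
   their contribution into a multiple of b^N; dividing by b^j shows that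
   the j-th coefficient, times a unit modulo b, is a multiple of b. *)
Let relation_dvd (Q : {poly {poly int}}) :
  (size Q <= N)%N -> (forall i, (size (Q`_i)%R < size g)%N) ->
  (map_poly ev Q).[b] = 0 -> forall i, exists t, Q`_i = d%:Z *: t.
Proof.
move=> szQ szg Qb i; case: (ltnP i N) => [iN|Ni]; last first.
  by exists 0; rewrite nth_default ?scaler0 // (leq_trans szQ).
have N0 : (0 < N)%N by apply: leq_ltn_trans iN.
have [w bN w_int] := b_pow N0; have b0 := b_neq0 N0.
suff [] : (exists t, Q`_i = d%:Z *: t) /\
    exists2 x, \sum_(l < i.+1) ev Q`_l * b ^+ l = d%:R * x & int_over x by [].
have step j : (j < N)%N ->
    (exists2 x, \sum_(l < j) ev Q`_l * b ^+ l = d%:R * x & int_over x) ->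
    (exists t, Q`_j = d%:Z *: t) /\
    exists2 x, \sum_(l < j.+1) ev Q`_l * b ^+ l = d%:R * x & int_over x.
  move=> jN [x xE x_int].
  pose y := \sum_(l < N - j.+1) ev Q`_(j.+1 + l) * b ^+ l.
  have y_int : int_over y.
    by apply: int_over_sum => l; apply: integral_mul;
      [exact: int_eval_integral | exact: int_overX].
  have relE : d%:R * x + b ^+ j * (ev Q`_j + b * y) = 0.
    rewrite -[RHS]Qb (@horner_coef_wide _ N) ?(leq_trans (size_poly _ _)) //.
    rewrite (eq_bigr (fun l : 'I_N => ev Q`_l * b ^+ l)) => [|l _]; last first.
      by rewrite coef_map.
    rewrite -[in RHS](subnKC jN) big_split_ord /= big_ord_recr /= xE -addrA.
    congr (_ + _); rewrite mulrDr; congr (_ + _); first by rewrite mulrC.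
    rewrite mulrA -exprSr mulr_sumr; apply: eq_bigr => l _.
    by rewrite exprD; ring.
  have divE : (ev u + b * w) * (ev Q`_j + b * y) = b * (b ^+ (N - j.+1) * x).
    apply: (mulfI (expf_neq0 j b0)); rewrite !mulrA -exprSr -exprD subnKC // bN.
    by rewrite -[RHS]addr0 -[in RHS](mulr0 (ev u + b * w)) -relE; ring.
  (* Solve [divE] for the coefficient, [ev v] being the inverse of [ev u]. *)
  pose r := ev v * (b ^+ (N - j.+1) * x - ev u * y - w * ev Q`_j - w * b * y).
  have r_int : int_over r.
    have eI := int_eval_integral.
    apply: integral_mul; first exact: eI.
    do 3?[apply: integral_sub]; repeat apply: integral_mul => //; try exact: eI.
    exact: int_overX.
  have qE : ev Q`_j = b * r.
    rewrite -[LHS]mul1r -uv1 /r.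
    have -> : b * (ev v * (b ^+ (N - j.+1) * x - ev u * y - w * ev Q`_j - w * b * y))
       = ev v * (b * (b ^+ (N - j.+1) * x)
                 - b * (ev u * y + w * ev Q`_j + w * b * y)).
      by ring.
    by rewrite -divE; ring.
  have qN : ev (Q`_j ^+ N) = d%:R * (- (ev u + b * w) * r ^+ N).
    by rewrite rmorphXn /= qE exprMn bN; ring.
  have [|t tE] := dvd_of_pow_integral_multiple _ _ _ (szg j) _ qN.
    apply: integral_mul; last exact: int_overX.
    apply: integral_opp; apply: integral_add; first exact: int_eval_integral.
    exact: integral_mul.
  split; first by exists t.
  exists (x + ev t * b ^+ j).
    by rewrite big_ord_recr /= xE tE int_evalZ -pmulrn; ring.
  apply: integral_add => //; apply: integral_mul;
    [exact: int_eval_integral | exact: int_overX].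
apply: (step) => //; elim: i iN => [|i IH] iN.
  by exists 0; [rewrite big_ord0 mulr0 | exact: integral0].
by have [] := step i (ltnW iN) (IH (ltnW iN)).
Qed.

Let relation_dvdX s (Q : {poly {poly int}}) :
  (size Q <= N)%N -> (forall i, (size (Q`_i)%R < size g)%N) ->
  (map_poly ev Q).[b] = 0 -> forall i, exists t, Q`_i = (d%:Z ^+ s) *: t.
Proof.
elim: s Q => [|s IH] Q szQ szg Qb i; first by exists Q`_i; rewrite scale1r.
have [t tE] := choice (relation_dvd Q szQ szg Qb).
have d0 : d%:Z != 0 by rewrite eqz_nat -lt0n prime_gt0.
have cE l : (\poly_(l < N) t l)`_l = t l.
  rewrite coef_poly; case: ltnP => // Nl; apply/esym/(scale_polyI _ _ d0).
  by rewrite -tE scaler0 nth_default // (leq_trans szQ).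
have [|l||t' t'E] := IH (\poly_(l < N) t l) _ _ _ i.
- exact: size_poly.
- by rewrite cE -(size_scale _ d0) -tE.
- have dF : d%:R != 0 :> F by rewrite pnatr_eq0 -lt0n prime_gt0.
  apply: (mulfI dF); rewrite mulr0 -[RHS]Qb -hornerZ; congr (_.[_]).
  by apply/polyP => l; rewrite coefZ !coef_map tE cE /= int_evalZ.
by exists t'; rewrite tE -cE t'E scalerA -exprS.
Qed.

(** Reduce the coefficients of a relation modulo [g].  By [relation_dvd] they
    are divisible by d, and dividing by d gives a relation of the same kind, so
    they are divisible by every power of d. *)
Lemma eisenstein_independence (Q : {poly {poly int}}) :
  (size Q <= N)%N -> (map_poly ev Q).[b] = 0 -> map_poly ev Q = 0.
Proof.
have gmon := um_monic _ _ _ _ gP.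
move=> szQ; pose rem p := Pdiv.Ring.rmodp p g.
have ev_rem p : ev (rem p) = ev p.
  rewrite [in RHS](Pdiv.RingMonic.rdivp_eq gmon p) rmorphD rmorphM /=.
  by rewrite (um_root _ _ _ _ gP) mulr0 add0r.
have rem0 : rem 0 = 0 by exact: Pdiv.Ring.rmod0p.
have -> : map_poly ev Q = map_poly ev (map_poly rem Q).
  by apply/polyP => i; rewrite !coef_map coef_map_id0 //= ev_rem.
move=> Qb; suff -> : map_poly rem Q = 0 by rewrite rmorph0.
have szg i : (size ((map_poly rem Q)`_i)%R < size g)%N.
  by rewrite coef_map_id0 // Pdiv.Ring.ltn_rmodpN0 // monic_neq0.
have dvdX s := relation_dvdX s _ (leq_trans (size_poly _ _) szQ) szg Qb.
apply/polyP => i; apply/polyP => j; rewrite !coef0.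
set x := _`_j; apply: contraTeq (leqnn `|x|) => x0.
have [t] := dvdX `|x|%N i.
move=> /(congr1 (fun p : {poly int} => p`_j)); rewrite -/x coefZ => xE.
have : (d ^ `|x| %| `|x|)%N.
  by rewrite {2}xE abszM abszX dvdn_mulr.
move=> /dvdn_leq; rewrite absz_gt0 x0 => /(_ isT).
by rewrite leqNgt ltn_expl ?prime_gt1.
Qed.

End Eisenstein.

(** * Irreducibility of the factors of the iterates *)

Lemma clear_denominators (K : fieldType) (z : K) (q : {poly K}) :
  (forall x : K, exists s t, int_eval K z t != 0 /\
     x * int_eval K z t = int_eval K z s) ->
  exists t (Q : {poly {poly int}}), [/\ int_eval K z t != 0,
    (size Q <= size q)%N & map_poly (int_eval K z) Q = int_eval K z t *: q].
Proof.
move=> fracK; have [num numP] := choice fracK; have [den denP] := choice numP.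
pose n := size q.
exists (\prod_(i < n) den q`_i),
  (\poly_(i < n) (num q`_i * \prod_(j < n | j != i :> nat) den q`_j)).
split; [|exact: size_poly|].
  rewrite rmorph_prod; apply/prodf_neq0 => i _; exact: (denP _).1.
apply/polyP => i; rewrite coefZ coef_map coef_poly /=.
case: ltnP => [ni|ni]; last by rewrite rmorph0 nth_default ?mulr0.
rewrite rmorphM /= -(denP _).2 -mulrA -rmorphM mulrC; congr (int_eval _ _ _ * _).
by rewrite [RHS](bigD1 (Ordinal ni)).
Qed.

(** A proper factor would have a root b in the algebraically closed field C,
    and its coefficients, cleared of denominators, would be a relation that
    [eisenstein_independence] excludes. *)
Lemma eisenstein_irreducible (C : numClosedFieldType) (K : fieldType)
    (iota : {rmorphism K -> C}) (d : nat) (z : K) (g : {poly int})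
    (S : {poly {poly int}}) (N : nat) (u v : {poly int}) :
  prime d -> unramified_minpoly C d (iota z) g ->
  (forall x : K, exists s t, int_eval K z t != 0 /\
     x * int_eval K z t = int_eval K z s) ->
  (0 < N)%N -> S \is monic -> size S = N.+1 ->
  map_poly (map_poly (intr : int -> 'F_d)) S = 'X^N -> S`_0 = u *+ d ->
  int_eval C (iota z) u * int_eval C (iota z) v = 1 ->
  irreducible_poly (map_poly (int_eval K z) S).
Proof.
move=> d_prime gP fracK N0 Smon Ssz Sred S0 uv1.
have PmapE (T : {poly {poly int}}) :
    map_poly iota (map_poly (int_eval K z) T) = map_poly (int_eval C (iota z)) T.
  by rewrite -map_poly_comp; apply: eq_map_poly => p /=; rewrite rmorph_int_eval.
have Pmon : map_poly (int_eval K z) S \is monic by exact: monic_map.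
have Psz : size (map_poly (int_eval K z) S) = N.+1.
  by rewrite size_map_poly_id0 // (monicP Smon) rmorph1 oner_eq0.
split=> [|q sq qP]; first by rewrite Psz.
have q0 : q != 0 by apply: contraTneq qP => ->; rewrite dvd0p monic_neq0.
rewrite -dvdp_size_eqp // Psz eqn_leq -{1}Psz dvdp_leq ?monic_neq0 //= ltnNge.
apply/negP => szq.
have /closed_rootP [b qb] : size (map_poly iota q) != 1%N by rewrite size_map_poly.
have Sb : (map_poly (int_eval C (iota z)) S).[b] = 0.
  apply/eqP; rewrite -PmapE -/(root _ b) -dvdp_XsubCl.
  apply: dvdp_trans (_ : map_poly iota q %| _); first by rewrite dvdp_XsubCl.
  by rewrite dvdp_map.
have [t [Q [t0 Qsz QE]]] := clear_denominators K z q fracK.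
have Qq : map_poly (int_eval C (iota z)) Q
    = iota (int_eval K z t) *: map_poly iota q by rewrite -PmapE QE map_polyZ.
have := eisenstein_independence _ _ _ _ d_prime gP _ _ _ _ _
  Smon Ssz Sred S0 uv1 Sb Q (leq_trans Qsz szq).
rewrite Qq hornerZ (eqP qb) mulr0 => /(_ erefl) /eqP.
by rewrite scale_poly_eq0 fmorph_eq0 (negPf t0) map_poly_eq0 (negPf q0).
Qed.

Lemma irreducible_shift (K : fieldType) (a : K) (p : {poly K}) :
  irreducible_poly (p \Po ('X + a%:P)) -> irreducible_poly p.
Proof.
have sz q : size (q \Po ('X + a%:P)) = size q.
  by rewrite size_comp_poly2 // size_XaddC.
case; rewrite sz => p1 irr; split=> // q q1 qp.
have := irr (q \Po ('X + a%:P)); rewrite sz => /(_ q1 (dvdp_comp_poly _ qp)).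
by move/eqp_size; rewrite !sz -dvdp_size_eqp // => ->.
Qed.

Lemma uiter_period (A : comNzRingType) d (c : A) n j :
  uiter A d c n 0 = 0 -> uiter A d c (j * n) 0 = 0.
Proof. by move=> n0; elim: j => // j IH; rewrite mulSn uiterD IH. Qed.

(** By [uiter_mul] one has 0 = a_j (1 + a_j r), so the inverse of a_j is -r. *)
Lemma uiter_unit (A : idomainType) d (c : A) n j : (1 < d)%N -> (0 < n)%N ->
  uiter A d c n 0 = 0 -> uiter A d c j 0 != 0 ->
  exists v, uiter A d c j 0 * int_eval A c v = 1.
Proof.
move=> d1 n0 an aj; have j0 : (0 < j)%N by case: j aj => //; rewrite eqxx.
have [r rE] := uiter_mul {poly int} d 'X j n d1 j0 n0.
exists (- r); have := congr1 (int_eval A c) rE.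
rewrite rmorphM rmorphD rmorph1 rmorphM !rmorph_uiter !rmorph0 /= int_evalX.
rewrite uiter_period // => /esym/eqP; rewrite mulf_eq0 (negPf aj) /= => /eqP E.
by rewrite rmorphN mulrN; apply/eqP; rewrite eq_sym -subr_eq0 opprK E.
Qed.

Lemma monic_uiterX (A : idomainType) d n : (1 < d)%N ->
  uiter {poly A} d 'X n.+1 0 \is monic /\
  size (uiter {poly A} d 'X n.+1 0) = (d ^ n).+1.
Proof.
move=> d1; elim: n => [|n [mon sz]].
  by rewrite uiterS /= expr0n gtn_eqF 1?ltnW // add0r expn0 monicX size_polyX.
have szX : size (uiter {poly A} d 'X n.+1 0 ^+ d) = (d ^ n.+1).+1.
  by rewrite size_monicX // sz /= expnSr.
have small : (size ('X : {poly A}) < (d ^ n.+1).+1)%N.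
  by rewrite size_polyX ltnS expnS (leq_trans d1) // leq_pmulr // expn_gt0 ltnW.
rewrite uiterS; split; last by rewrite size_polyDl szX.
by rewrite monicE lead_coefDl ?szX // -monicE monic_exp.
Qed.

Lemma deriv_uiterX (A : idomainType) d n :
  exists r : {poly A}, (uiter {poly A} d 'X n.+1 0)^`() = 1 + r *+ d.
Proof.
rewrite uiterS derivD derivX deriv_exp addrC.
by eexists.
Qed.

(** The minimal polynomial of z divides a_n, and modulo d the derivative of a_n
    in the parameter is 1, so a_n is separable. *)
Lemma unramified_minpoly_exists (F : numFieldType) d (z : F) n :
  prime d -> (0 < n)%N -> uiter F d z n 0 = 0 ->
  exists g, unramified_minpoly F d z g.
Proof.
move=> d_prime; case: n => // n _ an; have d1 := prime_gt1 d_prime.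
pose a := uiter {poly int} d 'X n.+1 0.
have ax : int_eval F z a = 0 by rewrite rmorph_uiter rmorph0 /= int_evalX.
have [g [gmon gx gmin]] := int_minpoly F z a (monic_uiterX int d n d1).1 ax.
exists g; split=> //; have [q aE] := gmin a ax.
apply: (@dvdp_separable _ (map_poly (intr : int -> 'F_d) a)).
  by rewrite aE rmorphM dvdp_mull.
rewrite rmorph_uiter rmorph0 /= map_polyX separable.separable_poly.unlock.
have [r ->] := deriv_uiterX 'F_d d n.
rewrite -mulr_natr -polyC_natr pchar_Fp_0 // polyC0 mulr0 addr0.
by rewrite coprimep1.
Qed.

(** After the shift by a_e the polynomial comes from Z[c][x], where it satisfies
    Eisenstein's criterion at d up to a power of a_(m+e) in the constant term;
    the period of z makes a_(m+e) a unit and d unramified. *)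
Lemma chord_irreducible (C : numClosedFieldType) (K : fieldType)
    (iota : {rmorphism K -> C}) (d n : nat) (z : K) (m e : nat) :
  prime d -> (0 < n)%N -> uiter K d z n 0 = 0 ->
  (forall x : K, exists s t, int_eval K z t != 0 /\
     x * int_eval K z t = int_eval K z s) ->
  uiter K d z (m + e) 0 != 0 ->
  irreducible_poly
    (chord {poly K} d (uiter {poly K} d z%:P m 'X) (uiter K d z (m + e) 0)%:P).
Proof.
move=> d_prime n0 an fracK aN; have d1 := prime_gt1 d_prime.
have an' : uiter C d (iota z) n 0 = 0.
  by rewrite -(rmorph0 iota) -rmorph_uiter an rmorph0.
have aN' : uiter C d (iota z) (m + e) 0 != 0.
  by rewrite -(rmorph0 iota) -rmorph_uiter (inj_eq (fmorph_inj iota)).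
have [g gP] := unramified_minpoly_exists C d (iota z) n d_prime n0 an'.
have [v vE] := uiter_unit C d (iota z) n (m + e) d1 n0 an' aN'.
pose a j := uiter {poly int} d 'X j 0.
pose X := uiter {poly {poly int}} d ('X)%:P m ('X + (a e)%:P).
pose S := chord {poly {poly int}} d X (a (m + e)%N)%:P.
have [Xmon Xsz] := size_uiter {poly int} d 'X (a e) m d1.
have Xsz1 : (1 < size X)%N by rewrite Xsz ltnS expn_gt0 ltnW.
have [Smon Ssz] := size_chord {poly int} d X (a (m + e)%N) d1 Xmon Xsz1.
rewrite Xsz /= in Ssz.
apply: (irreducible_shift K (uiter K d z e 0)).
have -> : chord {poly K} d (uiter {poly K} d z%:P m 'X) (uiter K d z (m + e) 0)%:P
      \Po ('X + (uiter K d z e 0)%:P) = map_poly (int_eval K z) S.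
  rewrite !rmorph_chord !rmorph_uiter /= rmorphD /= !map_polyX !map_polyC /=.
  rewrite !rmorph_uiter /= !map_polyC /= !comp_polyC comp_polyX int_evalX.
  by rewrite !rmorph0.
apply: (eisenstein_irreducible C K iota d z g S (d.-1 * d ^ m)
  (a (m + e)%N ^+ d.-1) (v ^+ d.-1)) => //.
- by rewrite muln_gt0 expn_gt0 (ltnW d1) andbT -ltnS prednK // ltnW.
- have dF : d \in [pchar {poly {poly 'F_d}}] by rewrite !pchar_poly pchar_Fp.
  pose a' j := uiter {poly 'F_d} d 'X j 0.
  have aE j : map_poly (intr : int -> 'F_d) (a j) = a' j.
    by rewrite rmorph_uiter rmorph0 /= map_polyX.
  rewrite rmorph_chord rmorph_uiter rmorphD /= !map_polyX !map_polyC /= map_polyX.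
  rewrite !aE uiter_pchar //.
  have -> : uiter {poly {poly 'F_d}} d ('X)%:P m (a' e)%:P = (a' (m + e)%N)%:P.
    by rewrite -rmorph_uiter /a' uiterD.
  rewrite chord_pchar // -?exprM 1?mulnC //.
  by rewrite expf_neq0 // polyX_eq0.
- rewrite -horner_coef0 -/(horner_eval 0 S) rmorph_chord rmorph_uiter rmorphD /=.
  rewrite /horner_eval hornerX !hornerC add0r -chord_diag; congr (chord _ _ _ _).
  by rewrite /a uiterD.
- by rewrite !rmorphXn /= rmorph_uiter rmorph0 /= int_evalX -exprMn vE expr1n.
Qed.

(** * The Moebius function *)

Lemma mobius_mul_prime p m : prime p -> (0 < m)%N -> ~~ (p %| m)%N ->
  mobius (p * m) = - mobius m.
Proof.
move=> pp m0 pm; have p0 := prime_gt0 pp.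
have primesE : perm_eq (primes (p * m)) (p :: primes m).
  apply: uniq_perm; rewrite /= ?primes_uniq ?andbT //.
    by rewrite mem_primes pp m0 (negPf pm).
  by move=> q; rewrite primesM // inE primes_prime // inE.
have logE q : q \in primes m -> logn q (p * m) = logn q m.
  move=> qm; rewrite lognM // logn_prime //.
  by case: eqP qm => // ->; rewrite mem_primes (negPf pm) !andbF.
have lp : logn p (p * m) = 1%N.
  by rewrite lognM // logn_prime // eqxx lognE pp m0 (negPf pm).
rewrite /mobius (perm_all _ primesE) (perm_size primesE) /= lp eqxx /=.
rewrite (@eq_in_all _ _ (fun q => logn q m == 1%N)) => [|q /logE -> //].
by case: ifP => // _; rewrite ?oppr0 // exprS mulN1r.
Qed.

Lemma mobius_neq0_logn p m : prime p -> (p %| m)%N -> (0 < m)%N ->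
  mobius m != 0 -> logn p m = 1%N.
Proof.
move=> pp pm m0; rewrite /mobius; case: ifP => [/allP lP _|_]; last by rewrite eqxx.
by apply/eqP/lP; rewrite mem_primes pp m0.
Qed.

(** For a prime p dividing n, the divisors with nonzero Moebius value are
    paired by k <-> pk, which changes the sign. *)
Lemma sum_mobius n : (0 < n)%N ->
  \sum_(k <- divisors n) mobius k = (n == 1%N)%:R.
Proof.
move=> n0; have [->|n1] := eqVneq n 1%N; first by rewrite big_seq1.
have pp : prime (pdiv n) by rewrite pdiv_prime // ltn_neqAle eq_sym n1.
have pn : (pdiv n %| n)%N := pdiv_dvd n.
move: (pdiv n) pp pn => p pp pn; have p0 := prime_gt0 pp.
pose D := [seq k <- divisors n | mobius k != 0].
have -> : \sum_(k <- divisors n) mobius k = \sum_(k <- D) mobius k.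
  by rewrite big_filter [RHS]big_mkcond; apply: eq_bigr => k _; case: eqP.
(* The pairing k <-> pk of the divisors not divisible by p with the others. *)
pose s k := if (p %| k)%N then (k %/ p)%N else (p * k)%N.
have DP k : k \in D -> [/\ mobius k != 0, (k %| n)%N & (0 < k)%N].
  rewrite mem_filter -dvdn_divisors // => /andP[m0 kn]; split=> //.
  exact: dvdn_gt0 kn.
have sP k : k \in D -> [/\ s k \in D, s (s k) = k & mobius (s k) = - mobius k].
  move=> kD; have [m0 kn k0] := DP k kD; rewrite /s.
  case: ifPn => pk.
    have lk := mobius_neq0_logn p k pp pk k0 m0.
    have kE := divnK pk; have q0 : (0 < k %/ p)%N by rewrite divn_gt0 // dvdn_leq.
    have pq : ~~ (p %| k %/ p)%N.
      apply/negP => pq; move: lk; rewrite -kE lognM // (@logn_prime p p) // eqxx.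
      by rewrite addn1 lognE pp q0 pq.
    have mE : mobius (k %/ p) = - mobius k.
      by rewrite -{2}kE mulnC mobius_mul_prime // opprK.
    rewrite (negPf pq) mulnC kE; split=> //.
    rewrite mem_filter mE oppr_eq0 m0 -dvdn_divisors //.
    by apply: dvdn_trans kn; rewrite -{2}kE dvdn_mulr.
  have mE := mobius_mul_prime p k pp k0 pk.
  rewrite dvdn_mulr // mulKn //; split=> //.
  rewrite mem_filter mE oppr_eq0 m0 -dvdn_divisors //.
  by rewrite Gauss_dvd ?pn ?kn // prime_coprime.
have permD : perm_eq [seq s k | k <- D] D.
  have sI : {in D &, injective s}.
    by move=> x y /sP[_ xE _] /sP[_ yE _] E; rewrite -xE E yE.
  apply: uniq_perm; rewrite ?filter_uniq ?divisors_uniq //.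
    by rewrite map_inj_in_uniq // filter_uniq // divisors_uniq.
  move=> k; apply/mapP/idP => [[j /sP[? _ _] ->] //|kD].
  by have [skD sk _] := sP k kD; exists (s k).
have E : \sum_(k <- D) mobius k = - \sum_(k <- D) mobius k.
  rewrite -{1}(perm_big _ permD) big_map -sumrN.
  by apply: eq_big_seq => k /sP[].
have : \sum_(k <- D) mobius k *+ 2 == 0 :> int by rewrite sumrMnl mulr2n {1}E addNr.
by rewrite sumrMnl mulrn_eq0 => /eqP.
Qed.

(** The map k -> n/k carries the divisors of n that are multiples of m to the
    divisors of n/m. *)
Lemma sum_mobius_multiples n m : (0 < n)%N -> (0 < m)%N ->
  \sum_(k <- divisors n | (m %| k)%N) mobius (n %/ k) = (n == m)%:R.
Proof.
move=> n0 m0; case: (boolP (m %| n)%N) => mn; last first.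
  have -> : (n == m) = false by apply/negP => /eqP E; rewrite E dvdnn in mn.
  rewrite big_seq_cond big1 // => k /andP[]; rewrite -dvdn_divisors // => kn mk.
  by rewrite (dvdn_trans mk kn) in mn.
have q0 : (0 < n %/ m)%N by rewrite divn_gt0 // dvdn_leq.
have -> : (n == m) = (n %/ m == 1)%N.
  apply/eqP/eqP => [->|E]; first by rewrite divnn m0.
  by rewrite -(divnK mn) E mul1n.
rewrite -sum_mobius // -big_filter.
have dvd_div k : (k %| n -> n %/ k %| n)%N.
  by move=> kn; rewrite -{2}(divnK kn) dvdn_mulr.
have divK k : (k %| n -> n %/ (n %/ k) = k)%N by move=> kn; rewrite divnA // mulKn.
rewrite -(big_map (fun k => n %/ k)%N predT (fun k => mobius k)) /=.
apply: perm_big; apply: uniq_perm; rewrite ?divisors_uniq //.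
  rewrite map_inj_in_uniq ?filter_uniq ?divisors_uniq // => x y.
  rewrite !mem_filter -!dvdn_divisors // => /andP[_ xn] /andP[_ yn] E.
  by rewrite -(divK x xn) E divK.
move=> k; rewrite -dvdn_divisors //; apply/mapP/idP.
  case=> j; rewrite mem_filter -dvdn_divisors // => /andP[mj jn] ->.
  by rewrite -{2}(divnK jn) -muln_divA // dvdn_mulr.
move=> kq; have kn : (k %| n)%N by rewrite (dvdn_trans kq) // dvd_div.
exists (n %/ k)%N; last by rewrite divK.
rewrite mem_filter -dvdn_divisors // dvd_div // andbT.
by rewrite dvdn_divRL // mulnC -dvdn_divRL.
Qed.

Lemma mobius_cases n : [\/ mobius n = 1, mobius n = -1 | mobius n = 0].
Proof.
rewrite /mobius; case: ifP => _; last exact: Or33.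
by rewrite -signr_odd; case: odd; rewrite ?expr0 ?expr1; [exact: Or32 | exact: Or31].
Qed.

(** * Roots of the Gleason polynomials *)

Lemma uiter_eq0_period (A : comNzRingType) d (c : A) n :
  (0 < n)%N -> uiter A d c n 0 = 0 ->
  exists m, [/\ (0 < m)%N, uiter A d c m 0 = 0 &
    forall k, uiter A d c k 0 = 0 <-> (m %| k)%N].
Proof.
move=> n0 an.
have ex : exists m, (0 < m)%N && (uiter A d c m 0 == 0).
  by exists n; rewrite n0 an eqxx.
have [m /andP[m0 /eqP am] mini] := ex_minnP ex.
exists m; split=> // k; split=> [ak|/dvdnP[j ->]]; last exact: uiter_period.
rewrite /dvdn; apply: contraTT isT => r0.
have ar : uiter A d c (k %% m) 0 = 0.
  by move: ak; rewrite {1}(divn_eq k m) addnC uiterD uiter_period.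
have := mini (k %% m)%N; rewrite lt0n r0 ar eqxx => /(_ isT).
by rewrite leqNgt ltn_mod m0.
Qed.

(** The derivative of a_k in c is 1 + d r with r in Z[c].  If it vanished at a
    root of a_k, which is an algebraic integer, then d would divide 1 among
    the algebraic integers. *)
Lemma uiter_simple_root (C : numClosedFieldType) d (z : C) k :
  prime d -> (0 < k)%N ->
  mup z (uiter {poly C} d 'X k 0) = (uiter C d z k 0 == 0) :> nat.
Proof.
move=> d_prime; case: k => // k _; have d1 := prime_gt1 d_prime.
set p := uiter {poly C} d 'X k.+1 0.
have p0 : p != 0 by rewrite monic_neq0 // (monic_uiterX C d k d1).1.
have pz : p.[z] = uiter C d z k.+1 0.
  by rewrite -[LHS]/(horner_eval z p) rmorph_uiter rmorph0 /= /horner_eval hornerX.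
case: eqP => az; last by rewrite mupNroot // /root pz; apply/eqP.
apply/eqP; rewrite eqn_leq mup_leq // mup_geq // expr1 dvdp_XsubCl /root pz az.
rewrite eqxx andbT; apply/negP => /dvdpP [q pE].
have dpz : p^`().[z] = 0.
  by rewrite pE derivM deriv_exp /= !hornerE subrr /=; ring.
have [g gP] := unramified_minpoly_exists C d z k.+1 d_prime isT az.
have [r rE] := deriv_uiterX int d k.
have pint : p = map_poly intr (uiter {poly int} d 'X k.+1 0).
  by rewrite rmorph_uiter rmorph0 /= map_polyX.
have E : int_eval C z ((-1) ^+ 1) = d%:R * int_eval C z r.
  have : int_eval C z (1 + r *+ d) = 0 by rewrite -rE /int_eval -deriv_map -pint.
  rewrite rmorphD rmorph1 rmorphMn rmorphXn rmorphN1 expr1 /= => /eqP.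
  by rewrite addrC addr_eq0 -mulr_natl => /eqP ->.
have g1 : (1 < size g)%N.
  rewrite ltnNge; apply/negP => /size1_polyC gE.
  have := um_monic _ _ _ _ gP; rewrite gE monicE lead_coefC => /eqP g1.
  have := um_root _ _ _ _ gP; rewrite gE g1 rmorph1 => /eqP.
  by rewrite oner_eq0.
have r_int : integralOver (intr : int -> C) (int_eval C z r).
  exact: int_eval_integral gP _.
have [|t tE] := dvd_of_pow_integral_multiple _ _ _ _ d_prime gP (-1) 1 _ _ r_int E.
  by rewrite size_polyN size_poly1.
have := congr1 (fun p : {poly int} => `|(p`_0)%R|%N) tE.
rewrite /= coefZ coefN coef1 abszM /= => /esym/eqP.
rewrite muln_eq1 => /andP[/eqP d1' _].
by rewrite d1' in d1.
Qed.

Lemma mup_prod (F : fieldType) (z : F) (I : eqType) (r : seq I) (p : I -> {poly F}) :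
  (forall i, p i != 0) -> mup z (\prod_(i <- r) p i) = (\sum_(i <- r) mup z (p i))%N.
Proof.
move=> p0; elim: r => [|i r IH].
  by rewrite !big_nil mupNroot // root1.
rewrite !big_cons mupM ?IH // prodf_seq_neq0.
by apply/allP => j _; rewrite p0 implybT.
Qed.

Lemma dvdp_mup (C : closedFieldType) (p q : {poly C}) :
  p != 0 -> q != 0 -> (forall z, (mup z p <= mup z q)%N) -> p %| q.
Proof.
have [r pE] := closed_field_poly_normal p.
rewrite {1}pE scale_poly_eq0 lead_coef_eq0 => /norP[p0 _].
have l0 : lead_coef p != 0 by rewrite lead_coef_eq0.
have mupE z : mup z p = count_mem z r.
  by rewrite pE -mul_polyC mupMr ?mu_prod_XsubC // rootC.
rewrite pE (dvdpZl _ _ l0) => q0.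
have : (forall z, (mup z p <= mup z q)%N) -> forall z, (count_mem z r <= mup z q)%N.
  by move=> le z; rewrite -mupE.
rewrite {1}pE => {}H /H {H}; elim: r q q0 {pE mupE} => [|x r IH] q q0 le.
  by rewrite big_nil dvd1p.
have : 'X - x%:P %| q.
  by rewrite -[_ - _]expr1 -mup_geq // (leq_trans _ (le x)) //= eqxx.
case/dvdpP => s sE; move: q0 le; rewrite sE big_cons mulrC.
rewrite mulf_eq0 => /norP[X0 s0] le; rewrite dvdp_mul2l // IH // => z.
have := le z; rewrite mupM // -['X - x%:P]expr1 mup_XsubCX /=.
by case: (x == z); rewrite leq_add2l.
Qed.

(** The numerator (s = 1) and the denominator (s = -1) of the Moebius product of
    the p k over the divisors k of n. *)
Definition mobius_part (n : nat) (s : int) (A : comNzRingType) (p : nat -> A) : A :=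
  \prod_(k <- divisors n) (if mobius (n %/ k) == s then p k else 1).

(** Clears the denominators in the identity that defines the Gleason
    polynomials. *)
Lemma prod_mobius (A : idomainType) (n : nat) (p : nat -> A) (G : A) :
  (forall k, (0 < k)%N -> p k != 0) -> (0 < n)%N ->
  tofrac G = \prod_(k <- divisors n) tofrac (p k) ^ mobius (n %/ k) <->
  G * mobius_part n (-1) A p = mobius_part n 1 A p.
Proof.
move=> p0 n0; have k0 k : k \in divisors n -> p k != 0.
  by rewrite -dvdn_divisors // => kn; apply: p0; exact: dvdn_gt0 kn.
have D0 : tofrac (mobius_part n (-1) A p) != 0.
  rewrite tofrac_eq0 prodf_seq_neq0; apply/allP => k kn /=.
  by case: ifP; rewrite ?oner_neq0 ?k0.
have -> : \prod_(k <- divisors n) tofrac (p k) ^ mobius (n %/ k) =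
    tofrac (mobius_part n 1 A p) / tofrac (mobius_part n (-1) A p).
  apply: (canRL (mulfK D0)); rewrite !rmorph_prod -big_split /=.
  apply: eq_big_seq => k /k0 pk; have pk' : tofrac (p k) != 0 by rewrite tofrac_eq0.
  case: (mobius_cases (n %/ k)) => ->; rewrite ?eqxx /=.
  - by rewrite expr1z tofrac1 mulr1.
  - by rewrite exprN1 mulVf // tofrac1.
  - by rewrite expr0z tofrac1 mulr1.
split=> GE; first by apply/eqP; rewrite -tofrac_eq tofracM GE divfK.
by apply: (canRL (mulfK D0)); rewrite -tofracM GE.
Qed.

Lemma mup_mobius_part (C : numClosedFieldType) d (z : C) n s :
  prime d -> (0 < n)%N ->
  mup z (mobius_part n s {poly C} (fun k => uiter {poly C} d 'X k 0)) =
  (\sum_(k <- divisors n | (uiter C d z k 0 == 0)%R) (mobius (n %/ k) == s))%N.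
Proof.
move=> d_prime n0; have d1 := prime_gt1 d_prime.
have -> : mobius_part n s {poly C} (fun k => uiter {poly C} d 'X k 0) =
    \prod_(k <- divisors n) (if (mobius (n %/ k) == s) && (0 < k)%N
                             then uiter {poly C} d 'X k 0 else 1).
  apply: eq_big_seq => k; rewrite -dvdn_divisors // => kn.
  by rewrite (dvdn_gt0 n0 kn) andbT.
rewrite mup_prod => [|k]; last first.
  case: ifP => [/andP[_]|_]; last exact: oner_neq0.
  by case: k => // k _; rewrite monic_neq0 // (monic_uiterX C d k d1).1.
rewrite [RHS]big_mkcond; apply: eq_big_seq => k.
rewrite -dvdn_divisors // => kn; rewrite (dvdn_gt0 n0 kn) andbT.
case: (_ == s); last by rewrite mupNroot ?root1 // if_same.
by rewrite uiter_simple_root ?(dvdn_gt0 n0 kn) //; case: eqP.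
Qed.

Definition primitive_period (A : comNzRingType) d (c : A) n :=
  uiter A d c n 0 = 0 /\ forall i, (0 < i < n)%N -> uiter A d c i 0 != 0.

Lemma sum_mobius_period (A : comNzRingType) d (c : A) n : (0 < n)%N ->
  \sum_(k <- divisors n | uiter A d c k 0 == 0) mobius (n %/ k) =
  `[< primitive_period A d c n >]%:R.
Proof.
move=> n0; case: (eqVneq (uiter A d c n 0) 0) => an; last first.
  rewrite (introF (asboolP _)) => [|[/eqP]]; last by rewrite (negPf an).
  rewrite big_seq_cond big1 // => k /andP[]; rewrite -dvdn_divisors //.
  move=> /dvdnP[j nE] /eqP /(uiter_period A d c k j).
  by rewrite -nE => /eqP; rewrite (negPf an).
have [m [m0 am mP]] := uiter_eq0_period A d c n n0 an.
rewrite (eq_bigl (fun k => (m %| k)%N)) => [|k]; last by apply/eqP/idP => /mP.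
rewrite sum_mobius_multiples //; congr (_%:R); congr nat_of_bool.
apply/eqP/asboolP => [->|[_ prim]].
  split=> // i /andP[i0 im]; apply/eqP => /mP /dvdn_leq - /(_ i0).
  by rewrite leqNgt im.
have mn : (m <= n)%N by rewrite dvdn_leq //; apply/mP.
apply/eqP; rewrite eqn_leq mn andbT leqNgt; apply/negP => lt_mn.
by have := prim m; rewrite m0 lt_mn am eqxx => /(_ isT).
Qed.

(** The excess of multiplicity at z is the sum of mu(n/k) over the divisors k of
    n with a_k(z) = 0, since these zeros are simple; it is 1 if z has exact
    period n and 0 otherwise. *)
Lemma mup_mobius_parts (C : numClosedFieldType) d (z : C) n :
  prime d -> (0 < n)%N ->
  mup z (mobius_part n 1 {poly C} (fun k => uiter {poly C} d 'X k 0)) =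
  (mup z (mobius_part n (-1) {poly C} (fun k => uiter {poly C} d 'X k 0))
   + `[< primitive_period C d z n >])%N.
Proof.
move=> d_prime n0; rewrite !mup_mobius_part //; apply/eqP.
rewrite -(eqr_nat int) natrD !natr_sum -sum_mobius_period // -big_split /=.
apply/eqP; apply: eq_bigr => k _.
by case: (mobius_cases (n %/ k)) => ->.
Qed.

Lemma rmorph_mobius_part (A B : comNzRingType) (f : {rmorphism A -> B}) n s p :
  f (mobius_part n s A p) = mobius_part n s B (fun k => f (p k)).
Proof.
by rewrite rmorph_prod; apply: eq_bigr => k _; case: ifP; rewrite ?rmorph1.
Qed.

Lemma monic_mobius_part (A : idomainType) d n s : (1 < d)%N -> (0 < n)%N ->
  mobius_part n s {poly A} (fun k => uiter {poly A} d 'X k 0) \is monic.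
Proof.
move=> d1 n0; rewrite /mobius_part big_seq; apply: monic_prod => k.
rewrite -dvdn_divisors // => /(dvdn_gt0 n0); case: k => // k _.
by case: ifP => _; rewrite ?monic1 ?(monic_uiterX A d k d1).1.
Qed.

(** The defining product lies in Z[c]: by [mup_mobius_parts] the denominator
    divides the numerator over an algebraically closed field, and since it is
    monic, Euclidean division by it over Z commutes with extension of scalars. *)
Lemma gleasonE d n : prime d -> (0 < n)%N ->
  gleason d n
    * mobius_part n (-1) {poly int} (fun k => uiter {poly int} d 'X k 0) =
  mobius_part n 1 {poly int} (fun k => uiter {poly int} d 'X k 0).
Proof.
move=> d_prime n0; have d1 := prime_gt1 d_prime.
set a := fun k => _; set D := mobius_part n (-1) _ a; set M := mobius_part n 1 _ a.
have a0 k : (0 < k)%N -> a k != 0.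
  by case: k => // k _; rewrite monic_neq0 // (monic_uiterX int d k d1).1.
have critE : \prod_(k <- divisors n) tofrac (crit_orbit d k) ^ mobius (n %/ k) =
             \prod_(k <- divisors n) tofrac (a k) ^ mobius (n %/ k).
  apply: eq_big_seq => k; rewrite -dvdn_divisors // => /(dvdn_gt0 n0).
  by case: k => // k _; rewrite crit_orbitE // ltnW.
rewrite /gleason critE.
suff [G GE] : exists G, G * D = M.
  have /(prod_mobius _ _ _ _ a0 n0) := GE.
  move=> GP; apply/(prod_mobius _ _ _ _ a0 n0).
  by case: xgetP => [//|/(_ G)].
have Dmon : D \is monic by exact: monic_mobius_part.
pose h := map_poly (intr : int -> algC).
have hE s : h (mobius_part n s {poly int} a)
    = mobius_part n s {poly algC} (fun k => uiter {poly algC} d 'X k 0).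
  rewrite /h rmorph_mobius_part; apply: eq_bigr => k _.
  by rewrite /a rmorph_uiter rmorph0 /= map_polyX.
have DM : h D %| h M.
  rewrite !hE; apply: dvdp_mup => [||z]; rewrite ?monic_neq0 ?monic_mobius_part //.
  by rewrite mup_mobius_parts // leq_addr.
have E := Pdiv.RingMonic.rdivp_eq Dmon M.
exists (Pdiv.Ring.rdivp M D); rewrite [RHS]E.
suff /eqP -> : Pdiv.Ring.rmodp M D == 0 by rewrite addr0.
have inj : injective h by apply: map_inj_poly => //; exact: intr_inj.
rewrite -(inj_eq inj) /h rmorph0; apply/negPn/negP => R0.
have : h D %| h (Pdiv.Ring.rmodp M D).
  rewrite -(dvdp_addr _ (dvdp_mull (h (Pdiv.Ring.rdivp M D)) (dvdpp (h D)))).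
  by rewrite /h -rmorphM -rmorphD -E.
move=> /dvdp_leq - /(_ R0); rewrite leqNgt => /negP; apply.
rewrite !size_map_inj_poly //; try exact: intr_inj.
by rewrite Pdiv.Ring.ltn_rmodpN0 // monic_neq0.
Qed.

Lemma gleason_root (C : numClosedFieldType) d n (z : C) :
  prime d -> (0 < n)%N -> root (map_poly intr (gleason d n)) z ->
  primitive_period C d z n.
Proof.
move=> d_prime n0 Gz; have d1 := prime_gt1 d_prime.
have := congr1 (map_poly (intr : int -> C)) (gleasonE d n d_prime n0).
have aE s : map_poly (intr : int -> C)
      (mobius_part n s {poly int} (fun k => uiter {poly int} d 'X k 0))
    = mobius_part n s {poly C} (fun k => uiter {poly C} d 'X k 0).
  rewrite rmorph_mobius_part; apply: eq_bigr => k _.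
  by rewrite rmorph_uiter rmorph0 /= map_polyX.
rewrite rmorphM /= !aE => E.
have M0 s : mobius_part n s {poly C} (fun k => uiter {poly C} d 'X k 0) != 0.
  by rewrite monic_neq0 // monic_mobius_part.
have G0 : map_poly intr (gleason d n) != 0 :> {poly C}.
  by apply: contraTneq (M0 1) => G0; rewrite -E G0 mul0r eqxx.
have := congr1 (mup z) E; rewrite mupM // mup_mobius_parts // addnC => /addnI.
case: asboolP => // _ /eqP; rewrite -leqn0 leqNgt -XsubC_dvd //.
by rewrite dvdp_XsubCl Gz.
Qed.

(** * Counting the factors *)

(** The fractions of values of integral polynomials form a subfield. *)
Lemma adjoin_fraction (F : fieldType) (z : F) (x : adjoin z) :
  exists s t, int_eval (adjoin z) (adjoin_gen z) t != 0 /\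
    x * int_eval (adjoin z) (adjoin_gen z) t
    = int_eval (adjoin z) (adjoin_gen z) s.
Proof.
pose S : {pred F} := fun y =>
  `[< exists s t, int_eval F z t != 0 /\ y * int_eval F z t = int_eval F z s >].
have SP y : y \in S <-> exists s t,
    int_eval F z t != 0 /\ y * int_eval F z t = int_eval F z s.
  by split=> [/asboolP|?]; last exact/asboolP.
have divS : divring_closed S.
  split=> [|y w /SP[s1 [t1 [t10 E1]]] /SP[s2 [t2 [t20 E2]]]
           |y w /SP[s1 [t1 [t10 E1]]] /SP[s2 [t2 [t20 E2]]]]; apply/SP.
  - by exists 1, 1; rewrite rmorph1 mulr1 oner_neq0.
  - exists (s1 * t2 - s2 * t1), (t1 * t2).
    by rewrite rmorphB !rmorphM /= mulf_neq0 // -E1 -E2; split=> //; ring.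
  - have [w0|w0] := eqVneq w 0.
      by exists 0, 1; rewrite w0 invr0 mulr0 mul0r rmorph1 rmorph0 oner_neq0.
    exists (s1 * t2), (t1 * s2).
    rewrite !rmorphM /= -E1 -E2 !mulf_neq0 //; split=> //.
    by field.
have zS : z \in S.
  by apply/SP; exists 'X, 1; rewrite rmorph1 oner_neq0 mulr1 int_evalX.
have /SP[s [t [t0 E]]] : val x \in S by have /in_adjoinP := adjoin_valP x; exact.
have valE p : val (int_eval (adjoin z) (adjoin_gen z) p) = int_eval F z p.
  exact: (rmorph_int_eval _ _ (val : {rmorphism adjoin z -> F})).
exists s, t; split.
  by apply: contraNneq t0 => t0; rewrite -valE t0 rmorph0.
by apply: val_inj; rewrite rmorphM /= !valE.
Qed.

Lemma irreducible_dvd_mul (K : fieldType) (g p q : {poly K}) :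
  irreducible_poly g -> g %| p * q -> (g %| p) || (g %| q).
Proof.
move=> irr gpq; case: (boolP (g %| p)) => //= gp.
by move: gpq; rewrite Gauss_dvdpr // irreducible_poly_coprime.
Qed.

Lemma irreducible_dvd_exp (K : fieldType) (g p : {poly K}) k :
  irreducible_poly g -> g %| p ^+ k -> g %| p.
Proof.
move=> irr; elim: k => [|k IH]; last first.
  by rewrite exprS => /(irreducible_dvd_mul _ _ _ _ irr) /orP[//|/IH].
by rewrite expr0 dvdp1 => /eqP s1; case: irr; rewrite s1.
Qed.

Lemma irreducible_dvd_eqp (K : fieldType) (g p : {poly K}) :
  irreducible_poly g -> irreducible_poly p -> g %| p -> g %= p.
Proof. by move=> irrg [_ irrp]; apply: irrp; case: irrg => s _; rewrite gtn_eqF. Qed.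

Lemma card_uniq_seq (T : choiceType) (s : seq T) :
  uniq s -> ([set` s] #= `I_(size s))%card.
Proof.
move=> us; have -> : [set` s]%classic = [set` seq_fset tt s]%classic.
  by apply/seteqP; split=> x; rewrite /mkset seq_fsetE.
by apply/card_eq_fsetP; rewrite size_seq_fset undup_id.
Qed.

(** As (m + k(n-1)) + (k - m) = kn, the condition says that n divides k - m, which
    runs over 1, ..., k. *)
Lemma count_dvd_shift n k : (0 < n)%N ->
  count (fun m => n %| m + k * n.-1)%N (iota 0 k) = (k %/ n)%N.
Proof.
move=> n0; rewrite -sum1_count big_mkcond /= divn_count_dvd big_add1 /=.
rewrite [RHS]big_nat_rev /= -{1}(subn0 k) -/(index_iota 0 k) !big_mkord.
apply: eq_bigr => i _; rewrite add0n subnSK //.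
have E : (n %| (i + k * n.-1) + (k - i))%N.
  by rewrite addnAC subnKC 1?ltnW // -mulnS prednK // dvdn_mull.
by rewrite (dvdn_add_eq E); case: (_ %| _)%N.
Qed.

Section Factors.

Variables (K : fieldType) (d : nat) (z : K) (e : nat).
Hypothesis d_gt1 : (1 < d)%N.

Local Notation a j := (uiter K d z j 0).
Local Notation f m := (uiter {poly K} d z%:P m 'X).

(** The quotient of f^(m+1) - a_(m+1+e) by f^m - a_(m+e), see
    [uiter_new_factor]. *)
Definition new_factor m : {poly K} := chord {poly K} d (f m) (a (m + e))%:P.

Lemma size_new_factor m :
  new_factor m \is monic /\ size (new_factor m) = (d.-1 * d ^ m).+1.
Proof.
have [mon sz] := size_uiter K d z 0 m d_gt1; rewrite polyC0 addr0 in mon sz.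
have [|cmon csz] := size_chord K d (f m) (a (m + e)) d_gt1 mon.
  by rewrite sz ltnS expn_gt0 ltnW.
by rewrite sz in csz.
Qed.

(** When this value is nonzero, [new_factor m] is not divisible by x - a_e; the
    case d = 2, m = 0 is not settled by the degrees. *)
Lemma root_new_factor m :
  (new_factor m).[a e] = a (m + e) ^+ d.-1 *+ d.
Proof.
rewrite -/(horner_eval (a e) _) rmorph_chord rmorph_uiter /= /horner_eval.
by rewrite hornerX !hornerC -uiterD chord_diag.
Qed.

Lemma uiter_new_factor m :
  f m.+1 - (a (m.+1 + e))%:P = (f m - (a (m + e))%:P) * new_factor m.
Proof.
have aE j : (a (j + e))%:P = uiter {poly K} d z%:P j (a e)%:P.
  by rewrite -rmorph_uiter uiterD.
by rewrite /new_factor !aE uiter_chord.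
Qed.

Lemma new_factor_dvd m k : (m < k)%N -> new_factor m %| f k - (a (k + e))%:P.
Proof.
elim: k => // k IH; rewrite ltnS leq_eqVlt uiter_new_factor => /orP[/eqP ->|/IH].
  exact: dvdp_mulIr.
exact: dvdp_mulr.
Qed.

Lemma XsubC_dvd_uiter k : 'X - (a e)%:P %| f k - (a (k + e))%:P.
Proof.
elim: k => [|k IH]; first exact: dvdpp.
by rewrite uiter_new_factor dvdp_mulr.
Qed.

(** If a_(k+e) = 0, the factor [new_factor k] is a power of f^k = f^k - a_(k+e),
    so that its irreducible factors have already been met. *)
Lemma irreducible_dvd_uiter g k : irreducible_poly g ->
  g %| f k - (a (k + e))%:P ->
  g %| 'X - (a e)%:P \/
  exists m, [/\ (m < k)%N, a (m + e) != 0 & g %| new_factor m].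
Proof.
move=> irr; elim: k => [|k IH] gk; first by left.
have {}IH : g %| f k - (a (k + e))%:P -> g %| 'X - (a e)%:P \/
    exists m, [/\ (m < k.+1)%N, a (m + e) != 0 & g %| new_factor m].
  by case/IH => [|[m [mk am gm]]]; [left | right; exists m; rewrite ltnW].
move: gk; rewrite uiter_new_factor => /(irreducible_dvd_mul _ _ _ _ irr) /orP[//|gk].
have [ak|ak] := eqVneq (a (k + e)) 0; last by right; exists k.
apply: IH; move: gk; rewrite /new_factor ak polyC0 subr0 chord0 1?ltnW //.
exact: irreducible_dvd_exp.
Qed.

Lemma irreducible_factors_uiter k :
  d%:R != 0 :> K -> a (k + e) = 0 ->
  (forall m, a (m + e) != 0 -> irreducible_poly (new_factor m)) ->
  (irreducible_factors (f k)
    #= `I_(count (fun m => a (m + e)%N != 0%R) (iota 0 k)).+1)%card.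
Proof.
move=> dK ak irr.
pose J := [seq m <- iota 0 k | a (m + e) != 0].
have JP m : m \in J = (a (m + e) != 0) && (m < k)%N.
  by rewrite mem_filter mem_iota add0n.
pose s := ('X - (a e)%:P) :: [seq new_factor m | m <- J].
have fE : f k = f k - (a (k + e))%:P by rewrite ak polyC0 subr0.
have -> : irreducible_factors (f k) = [set` s]%classic.
  apply/seteqP; split=> g /=.
    case=> gmon girr; rewrite fE => /(irreducible_dvd_uiter _ _ girr).
    rewrite inE => -[gX|[m [mk am gm]]].
      have := irreducible_dvd_eqp _ _ _ girr (irredp_XsubC _) gX.
      by rewrite eqp_monic ?monicXsubC // => ->.
    apply/orP; right; apply/mapP; exists m; first by rewrite JP am.
    have := irreducible_dvd_eqp _ _ _ girr (irr m am) gm.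
    by rewrite eqp_monic ?(size_new_factor m).1 // => /eqP.
  rewrite inE => /orP[/eqP ->|/mapP[m]].
    split; [exact: monicXsubC | exact: irredp_XsubC | by rewrite fE XsubC_dvd_uiter].
  rewrite JP => /andP[am mk] ->; split; first exact: (size_new_factor m).1.
    exact: irr.
  by rewrite fE new_factor_dvd.
have -> : (count (fun m => a (m + e)%N != 0%R) (iota 0 k)).+1 = size s.
  by rewrite /= size_map size_filter.
apply: card_uniq_seq; rewrite /= map_inj_in_uniq ?filter_uniq ?iota_uniq ?andbT //.
  apply/mapP => -[m]; rewrite JP => /andP[am _].
  move/(congr1 (fun p => p.[a e])); rewrite root_new_factor !hornerE subrr.
  move/esym/eqP; rewrite -mulr_natr mulf_eq0 (negPf dK) orbF.
  by rewrite expf_eq0 (negPf am) andbF.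
move=> m m' _ _ /(congr1 (fun p : {poly K} => size p)).
rewrite !(size_new_factor _).2 => -[/eqP].
have d0 : (0 < d.-1)%N by rewrite -ltnS prednK // ltnW.
by rewrite eqn_pmul2l // eqn_exp2l // => /eqP.
Qed.

End Factors.

Theorem corollary1p6 (R : realType) (d : nat) (hd : prime d)
    (n : nat) (hn : (2 <= n)%N) (c0 : R[i])
    (hc0 : root (map_poly intr (gleason d n)) c0)
    (k : nat) (hk : (1 <= k)%N) :
  (irreducible_factors (poly_iter (unicritical d (adjoin_gen c0)) k)
     #= `I_(k - k %/ n + 1)%N)%card.
Proof.
have d1 := prime_gt1 hd; have n0 : (0 < n)%N by apply: ltnW.
have [an prim] := gleason_root R[i] d n c0 hd n0 hc0.
pose K := adjoin c0; pose z : K := adjoin_gen c0.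
pose iota := (val : {rmorphism K -> R[i]}).
have iotaE j : iota (uiter K d z j 0) = uiter R[i] d c0 j 0.
  by rewrite rmorph_uiter rmorph0.
have anK : uiter K d z n 0 = 0 by apply: (fmorph_inj iota); rewrite iotaE an rmorph0.
have aP j : (uiter K d z j 0 == 0) = (n %| j)%N.
  have [m [m0 am mP]] := uiter_eq0_period K d z n n0 anK.
  suff <- : m = n by apply/eqP/idP => /mP.
  apply/eqP; rewrite eqn_leq dvdn_leq //=; last by apply/mP.
  rewrite leqNgt; apply/negP => mn.
  by have := prim m; rewrite m0 mn -iotaE am rmorph0 eqxx => /(_ isT).
rewrite poly_iterE -/K -/z.
(* The shift e = k(n-1) makes k + e = kn a multiple of the period. *)
have -> : (k - k %/ n + 1 = (count
    (fun m => uiter K d z (m + k * n.-1)%N 0%R != 0%R) (seq.iota 0 k)).+1)%N.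
  rewrite addn1; congr _.+1.
  rewrite -(count_dvd_shift n k n0) -{1}(size_iota 0 k).
  rewrite -(count_predC (fun m => n %| m + k * n.-1)%N) addKn.
  by apply: eq_count => m /=; rewrite aP.
apply: irreducible_factors_uiter => //.
- by rewrite -(fmorph_eq0 iota) rmorph_nat pnatr_eq0 -lt0n ltnW.
- by apply/eqP; rewrite aP -mulnS prednK // dvdn_mull.
- move=> m am; apply: (chord_irreducible R[i] K iota d n) => //.
  exact: adjoin_fraction.
Qed.
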